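(* There exists $n_0 \in \mathbb{N}$ such that for all integers $n > n_0$ and all integers $q \geq 0$, $$D(n,q) \;\geq\; \frac{2^n(n-2)}{3(n+q)\log_2 (n+q)} - \frac{n}{3(n+q)}.$$
   Context: For $N\ge 1$, $j\in\{1,\dots,N\}$ and $I \subseteq \{1,\dots,N\}\setminus\{j\}$, the gate $TOF(I;j)$ on $N$ inputs defines the transformation $\mathbb{Z}_2^N \to \mathbb{Z}_2^N$ that replaces $x_j$ by $x_j \oplus \bigwedge_{i\in I} x_i$ and leaves all other coordinates unchanged; for $I=\emptyset$ it is the NOT gate $x_j \mapsto x_j\oplus 1$. Let $\Omega_N^2$ be the set of all gates $TOF(I;j)$ on $N$ inputs with $|I|\le 2$ (NOT, CNOT and 2-CNOT gates). A reversible circuit $\mathfrak{S}$ with $N$ inputs is a finite sequence (composition) of $l\ge 0$ gates from $\Omega_N^2$, applied one after another; it defines a transformation $g:\mathbb{Z}_2^N\to\mathbb{Z}_2^N$. A (nonempty) circuit has depth $1$ if for any two distinct gates $TOF(I_1;t_1)$, $TOF(I_2;t_2)$ occurring in it (distinct positions), $(\{t_1\}\cup I_1)\cap(\{t_2\}\cup I_2)=\emptyset$. The depth $D(\mathfrak{S})$ is the minimal $d$ such that the sequence $\mathfrak{S}$ can be divided into $d$ disjoint consecutive sub-circuits each of depth $1$. A reversible circuit with $n+q$ inputs ($q\ge 0$) defining $g:\mathbb{Z}_2^{n+q}\to\mathbb{Z}_2^{n+q}$ implements $f:\mathbb{Z}_2^n\to\mathbb{Z}_2^n$ with $q$ additional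 inputs if there is a permutation $\pi$ of $\{1,\dots,n+q\}$ such that for every $x\in\mathbb{Z}_2^n$, writing $g(x_1,\dots,x_n,0,\dots,0) = (y_1,\dots,y_{n+q})$, one has $f(x) = (y_{\pi(1)},\dots,y_{\pi(n)})$. $F(n,q)$ is the set of all transformations $\mathbb{Z}_2^n\to\mathbb{Z}_2^n$ that can be implemented by reversible circuits with $n+q$ inputs (gates from $\Omega_{n+q}^2$). For $f\in F(n,q)$, $D(f,q)$ is the minimum of $D(\mathfrak{S})$ over all circuits $\mathfrak{S}$ of gates from $\Omega_{n+q}^2$ implementing $f$ with $q$ additional inputs, and $D(n,q) = \max_{f\in F(n,q)} D(f,q)$. *)

(* Defs.v *)
From HB Require Import structures.
From mathcomp Require Import all_boot all_order all_algebra all_fingroup.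
From mathcomp Require Import boolp classical_sets reals exp.

Set Implicit Arguments.
Unset Strict Implicit.
Unset Printing Implicit Defensive.

Import Order.TTheory GRing.Theory Num.Theory.
Local Open Scope ring_scope.

(* The pair (I, j) is the gate TOF(I; j). *)
Definition tof (N : nat) := {g : {set 'I_N} * 'I_N | g.2 \notin g.1}.

Definition controls N (g : tof N) : {set 'I_N} := (val g).1.
Definition target N (g : tof N) : 'I_N := (val g).2.
Definition support N (g : tof N) : {set 'I_N} := target g |: controls g.

(* In 'F_2 the sum is xor and the product is conjunction; the empty product
   is 1, so a gate without controls is NOT. *)
Definition tof_fun N (g : tof N) (x : 'rV['F_2]_N) : 'rV['F_2]_N :=
  \row_k (if k == target g then x 0 k + \prod_(i in controls g) x 0 i
          else x 0 k).

Definition Omega2 (N : nat) : {set tof N} := [set g | #|controls g| <= 2]%N.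

(* The gate at the head of the sequence is applied first. *)
Definition circuit_fun N (s : seq (tof N)) (x : 'rV['F_2]_N) : 'rV['F_2]_N :=
  foldl (fun y g => tof_fun g y) x s.

(* [pairwise] ranges over pairs of distinct positions. *)
Definition depth1 N (s : seq (tof N)) : bool :=
  (s != [::]) && pairwise (fun g h => [disjoint support g & support h]) s.

Definition divisible_into N (s : seq (tof N)) (d : nat) : Prop :=
  exists ss : seq (seq (tof N)),
    [/\ flatten ss = s, size ss = d & all (@depth1 N) ss].

(* The least natural number satisfying P (0 if there is none). *)
Definition least (P : nat -> Prop) : nat :=
  xget 0%N [set d | P d /\ forall e, P e -> (d <= e)%N]%classic.

Lemma leastP (P : nat -> Prop) :
  (exists d, P d) -> P (least P) /\ forall e, P e -> (least P <= e)%N.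
Proof.
move=> exP; apply: (@xgetPex _ 0%N [set d | P d /\ forall e, P e -> (d <= e)%N]%classic).
have exb : exists d, `[< P d >] by case: exP => d Pd; exists d; apply/asboolP.
case: (ex_minnP exb) => m /asboolP Pm minm; exists m; split=> // e Pe.
by apply: minm; apply/asboolP.
Qed.

Definition depth N (s : seq (tof N)) : nat := least (divisible_into s).

Lemma depthP N (s : seq (tof N)) :
  divisible_into s (depth s) /\
  forall e, divisible_into s e -> (depth s <= e)%N.
Proof.
apply: leastP; exists (size s); exists [seq [:: g] | g <- s].
by rewrite flatten_seq1 size_map; split=> //; apply/allP => _ /mapP[g _ ->].
Qed.

Definition implements n q (s : seq (tof (n + q)))
    (f : {ffun 'rV['F_2]_n -> 'rV['F_2]_n}) : Prop :=
  exists pi : 'S_(n + q), forall x : 'rV['F_2]_n,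
    f x = \row_(i < n) circuit_fun s (row_mx x 0) 0 (pi (lshift q i)).

Definition realizable_depth n q (f : {ffun 'rV['F_2]_n -> 'rV['F_2]_n})
    (d : nat) : Prop :=
  exists s : seq (tof (n + q)),
    [/\ {subset s <= Omega2 (n + q)}, implements s f & depth s = d].

Definition F n q : {set {ffun 'rV['F_2]_n -> 'rV['F_2]_n}} :=
  [set f | `[< exists s : seq (tof (n + q)),
                 {subset s <= Omega2 (n + q)} /\ implements s f >]].

(* D(f, q), meaningful for f \in F n q. *)
Definition Dfun n q (f : {ffun 'rV['F_2]_n -> 'rV['F_2]_n}) : nat :=
  least (realizable_depth q f).

Lemma DfunP n q (f : {ffun 'rV['F_2]_n -> 'rV['F_2]_n}) : f \in F n q ->
  realizable_depth q f (Dfun q f) /\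
  forall e, realizable_depth q f e -> (Dfun q f <= e)%N.
Proof.
rewrite inE => /asboolP[s [sO sf]].
by apply: leastP; exists (depth s), s.
Qed.

Definition D (n q : nat) : nat := (\max_(f in F n q) Dfun q f)%N.

Definition log2 (R : realType) (x : R) : R := ln x / ln 2.

(* Main.v *)
Require Import Defs.
From mathcomp Require Import all_boot all_order all_algebra all_fingroup.
From mathcomp Require Import boolp classical_sets reals exp.
From mathcomp Require Import ring lra.
(* Re-imported because classical_sets shadows the finite-set names. *)
From mathcomp Require Import fintype finset.

Set Implicit Arguments.
Unset Strict Implicit.
Unset Printing Implicit Defensive.

Import Order.TTheory GRing.Theory Num.Theory.
Local Open Scope ring_scope.

(* A layer of depth 1 on N = n + q lines is determined by choosing, for
   each line, its controls (if it is a target), which leaves at most N^(3N)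
   layers; hence, with the N^n choices for the outputs,
     |F(n,q)| <= N^(3 N D(n,q) + n).
   Conversely, for n >= 4 the permutations computed without additional inputs
   form a group G of index at most 2 in Sym(Z_2^n). Gates with up to n-2 controls
   are commutators of smaller ones. A gate with n-2 controls is a product of two
   disjoint transpositions; multiplied by a suitable conjugate of itself it
   yields a 3-cycle (1, 1+e_j, 1+e_k), which is translated by NOT gates. So all
   edge transpositions of the hypercube, and then all transpositions, lie in one
   coset of G. Therefore (2^n)! <= 2 |F(n,q)|, and m^m <= 4^m m!/2 for m = 2^n
   gives the bound after taking logarithms. *)

(** * Gates as involutions of the vector space over ['F_2] *)

Lemma addrr_F2 n (v : 'rV['F_2]_n) : v + v = 0.
Proof. by rewrite -mulr2n -scaler_nat pchar_Fp_0 ?scale0r. Qed.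

Lemma F2_eq0 (a : 'F_2) : (a == 0) = (a != 1).
Proof. by case: a => [[|[|]]]. Qed.

Lemma F2_neq (a b : 'F_2) : a != b -> a = b + 1.
Proof.
by move=> ab; apply/eqP; case: a b ab => [[|[|]]] // ? [[|[|]]].
Qed.

Definition ctrl n (g : tof n) (x : 'rV['F_2]_n) : 'F_2 :=
  \prod_(i in controls g) x 0 i.

Lemma tof_funE n (g : tof n) x :
  tof_fun g x = x + ctrl g x *: delta_mx 0 (target g).
Proof.
apply/rowP => k; rewrite !mxE eqxx /=.
by case: eqP => _; rewrite ?mulr1 // mulr0 addr0.
Qed.

Lemma ctrlD n (g : tof n) x a (j : 'I_n) : j \notin controls g ->
  ctrl g (x + a *: delta_mx 0 j) = ctrl g x.
Proof.
move=> jg; apply: eq_bigr => i ig; rewrite !mxE eqxx /=.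
by case: eqP ig => [->|]; rewrite ?(negPf jg) // mulr0 addr0.
Qed.

Lemma tof_funK n (g : tof n) : involutive (tof_fun g).
Proof.
move=> x; rewrite !tof_funE ctrlD ?(valP g) //.
by rewrite -addrA addrr_F2 addr0.
Qed.

Definition tof_perm n (g : tof n) : {perm 'rV['F_2]_n} :=
  perm (inv_inj (@tof_funK n g)).

Lemma tof_permE n (g : tof n) x :
  tof_perm g x = x + ctrl g x *: delta_mx 0 (target g).
Proof. by rewrite permE tof_funE. Qed.

(** * The group of permutations computed without additional inputs *)

Definition reversible n : {set {perm 'rV['F_2]_n}} :=
  [set p : {perm 'rV['F_2]_n} | `[< exists s : seq (tof n),
     {subset s <= Omega2 n} /\ circuit_fun s =1 p >]].

Lemma reversibleP n (p : {perm 'rV['F_2]_n}) :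
  p \in reversible n <->
  exists s : seq (tof n), {subset s <= Omega2 n} /\ circuit_fun s =1 p.
Proof. by rewrite inE; split=> /asboolP. Qed.

Lemma reversible_group_set n : group_set (reversible n).
Proof.
apply/group_setP; split.
  by apply/reversibleP; exists [::]; split=> // x; rewrite perm1.
move=> p1 p2 /reversibleP[s1 [O1 E1]] /reversibleP[s2 [O2 E2]].
apply/reversibleP; exists (s1 ++ s2); split=> [g|x].
  by rewrite mem_cat => /orP[/O1|/O2].
by rewrite /circuit_fun foldl_cat permM -E1 -E2.
Qed.
Canonical reversible_group n := Group (reversible_group_set n).

(** Removing [j] from [I] makes the side condition of [tof] hold for every [I] and [j]. *)
Definition gate n (I : {set 'I_n}) (j : 'I_n) : tof n :=
  exist (fun g : {set 'I_n} * 'I_n => g.2 \notin g.1) (I :\ j, j) (negbT (setD11 j I)).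

Lemma controls_gate n (I : {set 'I_n}) j : controls (gate I j) = I :\ j.
Proof. by []. Qed.

Lemma target_gate n (I : {set 'I_n}) j : target (gate I j) = j.
Proof. by []. Qed.

Lemma gate_eta n (g : tof n) : g = gate (controls g) (target g).
Proof.
apply: val_inj; case: g => [[I j] /= jI].
rewrite /controls /target /=; congr pair.
by apply/setP => i; rewrite !inE; case: eqP => // ->; apply: negPf.
Qed.

(** With a, b the products over [I] and [J], line [j] receives (x_t + a) b and later x_t b, in total
    ab; line [t] receives a twice and is restored. *)
Lemma tof_perm_commutator n (I J : {set 'I_n}) (j t : 'I_n) :
  j \notin I -> t \notin I -> j \notin J -> t \notin J -> [disjoint I & J] -> t != j ->
  tof_perm (gate (I :|: J) j) =
  (tof_perm (gate I t) * tof_perm (gate (t |: J) j) *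
   tof_perm (gate I t) * tof_perm (gate (t |: J) j))%g.
Proof.
move=> jI tI jJ tJ IJ tj.
set P := gate I t; set Q := gate (t |: J) j.
have cP : controls P = I.
  by apply/setP => i; rewrite !inE; case: eqP => // ->; rewrite (negPf tI).
have cQ : controls Q = t |: J.
  apply/setP => i; rewrite !inE; case: eqP => // ->.
  by rewrite (negPf jJ) orbF eq_sym (negPf tj).
have ctrlQ x : ctrl Q x = x 0 t * \prod_(i in J) x 0 i.
  by rewrite /ctrl cQ big_setU1.
have ctrlIJ x : ctrl (gate (I :|: J) j) x = ctrl P x * \prod_(i in J) x 0 i.
  rewrite /ctrl cP -bigU //=; apply: eq_bigl => i; rewrite !inE.
  by case: eqP => // ->; rewrite (negPf jI) (negPf jJ).
have JD x a k : k \notin J -> \prod_(i in J) (x + a *: delta_mx 0 k : 'rV['F_2]_n) 0 i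
    = \prod_(i in J) x 0 i.
  move=> kJ; apply: eq_bigr => i iJ; rewrite !mxE eqxx /=.
  by case: eqP iJ => [->|]; rewrite ?(negPf kJ) // mulr0 addr0.
apply/permP => x; rewrite !permM !tof_permE.
rewrite !target_gate ctrlIJ !ctrlQ.
rewrite !(@ctrlD _ P) ?cP // !JD //.
set a := ctrl P x; set b := \prod_(i in J) x 0 i.
rewrite !mxE !eqxx /= (eq_sym t j) (negPf (_ : j != t)) 1?eq_sym //=.
rewrite !mulr0 !addr0 !mulr1.
have aa (c : 'F_2) : c + c = 0 by rewrite -mulr2n -mulr_natl pchar_Fp_0 // mul0r.
rewrite -[x 0 t + a + a]addrA aa addr0 (addrAC (x + _)) -(addrA x) addrr_F2 addr0.
by rewrite -addrA -scalerDl mulrDl addrAC aa add0r.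
Qed.

Lemma tof_perm_Omega2 n (g : tof n) :
  g \in Omega2 n -> tof_perm g \in reversible n.
Proof.
move=> gO; apply/reversibleP; exists [:: g]; split=> [h|x].
  by rewrite inE => /eqP->.
by rewrite permE.
Qed.

(** Induction on the number of controls: the commutator of a gate controlled by two of them and a
    gate with one control fewer. *)
Lemma tof_perm_reversible n (g : tof n) :
  (#|controls g|.+1 < n)%N -> tof_perm g \in reversible n.
Proof.
have [k] := ubnP #|controls g|; elim: k => // k IHk in g * => ltk ltn.
have [le2|gt2] := leqP #|controls g| 2; first by apply: tof_perm_Omega2; rewrite inE.
have [a [b [aI bI ab]]] := card_gt1P (ltnW gt2).
have jI : target g \notin controls g := valP g.
(* The cardinality hypothesis leaves a line [t] outside the gate to hold the intermediate
   product. *)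
have [t] : exists t, t \notin target g |: controls g.
  apply/existsP; rewrite -negb_forall; apply/negP => /forallP tI.
  have /subset_leq_card : [set: 'I_n] \subset target g |: controls g.
    by apply/subsetP => t _; apply: tI.
  by rewrite cardsT card_ord cardsU1 jI leqNgt ltn.
rewrite in_setU1 => /norP[tj tI].
set A := [set a; b]; set B := controls g :\: A.
have AI : A \subset controls g by rewrite subUset !sub1set aI bI.
have defI : controls g = A :|: B.
  by rewrite -{1}(setID (controls g) A) (setIidPr AI).
have cardA : #|A| = 2%N by rewrite cards2 ab.
have cardB : (#|B|.+2 = #|controls g|)%N by rewrite cardsDS // cardA -addn2 subnK // ltnW.
have cardtB : (#|(t |: B) :\ target g| <= #|B|.+1)%N.
  apply: leq_trans (subset_leq_card (subsetDl _ _)) _.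
  by rewrite cardsU1 -add1n leq_add2r leq_b1.
have cardAt : (#|A :\ t| <= 2)%N by rewrite -cardA subset_leq_card ?subsetDl.
have PG : tof_perm (gate A t) \in reversible n by apply: tof_perm_Omega2; rewrite inE.
have QG : tof_perm (gate (t |: B) (target g)) \in reversible n.
  apply: IHk; first by apply: leq_ltn_trans cardtB _; rewrite cardB.
  by apply: leq_ltn_trans ltn; rewrite -cardB controls_gate ltnS ltnW.
have IJ : [disjoint A & B] by rewrite -setI_eq0 setIDA setDIl setDv set0I.
have notin i : i \notin controls g -> (i \notin A) && (i \notin B).
  by rewrite defI inE negb_or.
have /andP[jA jB] := notin _ jI; have /andP[tA tB] := notin _ tI.
by rewrite (gate_eta g) defI (@tof_perm_commutator _ A B _ t) ?groupM.
Qed.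

Lemma shift_reversible n (v : 'rV['F_2]_n) : perm (addIr v) \in reversible n.
Proof.
rewrite [v]row_sum_delta.
elim/big_rec: _ => [|j w _ IHw].
  by rewrite (_ : perm _ = 1%g) ?group1 //; apply/permP => x; rewrite permE perm1 addr0.
have Nj : tof_perm (gate set0 j) \in reversible n.
  by apply: tof_perm_Omega2; rewrite inE controls_gate set0D cards0.
have [->|vj] := eqVneq (v 0 j) 0; first by rewrite scale0r add0r.
have {vj}-> : v 0 j = 1 by apply/eqP; rewrite F2_eq0 negbK in vj.
rewrite (_ : perm _ = tof_perm (gate set0 j) * perm (addIr w))%g ?groupM //.
apply/permP => x; rewrite permM !permE tof_funE /ctrl controls_gate set0D big_set0.
by rewrite addrA.
Qed.

(** * Gates as products of edge transpositions of the hypercube *)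

Lemma delta_neq0 n (j : 'I_n) : delta_mx 0 j != 0 :> 'rV['F_2]_n.
Proof. by apply/eqP => /rowP/(_ j); rewrite !mxE !eqxx. Qed.

(** This has the shape of [tof_permE], so gates and edge transpositions can be compared through the
    coefficient of [delta_mx 0 j]. *)
Lemma edge_tpermE n (x y : 'rV['F_2]_n) j :
  tperm x (x + delta_mx 0 j) y =
  y + [forall i, (i != j) ==> (y 0 i == x 0 i)]%:R *: delta_mx 0 j.
Proof.
case: forallP => [yx|nyx]; rewrite ?scale1r ?scale0r ?addr0; last first.
  by rewrite tpermD //; apply/eqP => yE; case: nyx => i; apply/implyP => ij;
    rewrite -yE // !mxE eqxx (negPf ij) addr0.
have [->|neq] := eqVneq y x; first by rewrite tpermL.
suff -> : y = x + delta_mx 0 j by rewrite tpermR -addrA addrr_F2 addr0.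
apply/rowP => i; rewrite !mxE eqxx /=.
case: (eqVneq i j) (yx i) => [-> _|ij /eqP->]; last by rewrite addr0.
apply: F2_neq; apply: contraNneq neq => yj; apply/eqP/rowP => k.
by case: (eqVneq k j) (yx k) => [->|_ /eqP].
Qed.

(** The gate fires when all lines other than [j] and [m] carry 1. Line [m] is free, so the firing
    set consists of two edges in direction [j], one for each value of line [m]. *)
Lemma tof_perm_double n (j m : 'I_n) (u := const_mx 1 : 'rV['F_2]_n) : j != m ->
  tof_perm (gate (~: [set j; m]) j) =
  (tperm u (u + delta_mx 0 j) *
   tperm (u + delta_mx 0 m) (u + delta_mx 0 m + delta_mx 0 j))%g.
Proof.
move=> jm; apply/permP => y; rewrite permM tof_permE !edge_tpermE -addrA -scalerDl.
rewrite target_gate; congr (_ + _ *: _).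
set b1 := [forall i, _]; set b2 := [forall i, _].
(* The first transposition changes only line [j], which the second indicator does not test. *)
have -> : b2 = [forall i, (i != j) ==> (y 0 i == (u + delta_mx 0 m) 0 i)].
  apply: eq_forallb => i; case: eqVneq => //= ij.
  by rewrite 4!mxE eqxx (negPf ij) mulr0 addr0.
rewrite /ctrl controls_gate /b1 {b1 b2}.
case: (boolP [forall i, (i \notin [set j; m]) ==> (y 0 i == 1)]) => [/forallP y1|].
  rewrite big1 => [|i]; last first.
    by rewrite !inE => /andP[_ ijm]; apply/eqP/(implyP (y1 i)); rewrite !inE.
  have E b : [forall i, (i != j) ==> (y 0 i == (u + b *: delta_mx 0 m) 0 i)] =
      (y 0 m == 1 + b).
    apply/forallP/idP => [/(_ m)|/eqP ym i].
      by rewrite eq_sym jm !mxE !eqxx mulr1.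
    apply/implyP => ij; rewrite !mxE eqxx /=; case: (eqVneq i m) => [->|im].
      by rewrite ym mulr1.
    by rewrite mulr0 addr0; apply: (implyP (y1 i)); rewrite !inE negb_or ij.
  move: (E 0) (E 1); rewrite scale0r scale1r !addr0 => -> ->.
  rewrite (_ : 1 + 1 = 0); last exact/eqP.
  by rewrite F2_eq0; case: (_ == _); rewrite ?addr0 ?add0r.
case/forallPn => i; rewrite negb_imply !inE negb_or => /andP[/andP[ij im] yi].
have N b : [forall i, (i != j) ==> (y 0 i == (u + b *: delta_mx 0 m) 0 i)] = false.
  apply/negP => /forallP/(_ i); rewrite ij !mxE eqxx (negPf im) mulr0 addr0.
  by rewrite (negPf yi).
move: (N 0) (N 1); rewrite scale0r scale1r !addr0 => -> ->.
rewrite addr0 (bigD1 i) /=; last by rewrite !inE negb_or ij im.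
by move: yi; rewrite -F2_eq0 => /eqP->; rewrite mul0r.
Qed.

Lemma tof_perm_double_reversible n (j m : 'I_n) : j != m ->
  tof_perm (gate (~: [set j; m]) j) \in reversible n.
Proof.
move=> jm; apply: tof_perm_reversible; rewrite controls_gate.
have := cardsC [set j; m]; rewrite card_ord cards2 jm => En.
by rewrite -[X in (_ < X)%N]En add2n !ltnS subset_leq_card // subsetDl.
Qed.

Lemma tof_perm_fix n (g : tof n) (i : 'I_n) (x : 'rV['F_2]_n) :
  i \in controls g -> x 0 i = 0 -> tof_perm g x = x.
Proof.
by move=> ig xi; rewrite tof_permE /ctrl (bigD1 i) //= xi mul0r scale0r addr0.
Qed.

(** Choose [m], [l] so that [j], [k], [m], [l] are distinct, whence [3 < n]. [Q] sends [u] to u +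
    e_k and fixes the other three points moved by [P], since each has a 0 at a control of [Q]. Hence
    in P (P^Q)^-1 the second transpositions cancel. *)
Lemma tperm_adjacent_reversible n (j k : 'I_n) (u := const_mx 1 : 'rV['F_2]_n) :
  (3 < n)%N -> j != k ->
  (tperm u (u + delta_mx 0 j) * tperm (u + delta_mx 0 k) (u + delta_mx 0 j))%g
    \in reversible n.
Proof.
move=> n3 jk.
have [m [l [mA lA ml]]] : exists m l,
    [/\ m \in ~: [set j; k], l \in ~: [set j; k] & m != l].
  apply/card_gt1P; have := cardsC [set j; k]; rewrite card_ord cards2 jk => En.
  by rewrite -[X in (_ < X)%N]En in n3.
move: mA lA; rewrite !in_setC !in_set2 => /norP[mj mk] /norP[lj lk].
have jm : j != m by rewrite eq_sym.
have kl : k != l by rewrite eq_sym.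
have PG := tof_perm_double_reversible jm.
have QG := tof_perm_double_reversible kl.
have Pd := tof_perm_double jm.
set P := tof_perm _ in PG Pd; set Q := tof_perm _ in QG.
have uv (v : 'rV['F_2]_n) i : v 0 i = 1 -> (u + v) 0 i = 0.
  by move=> vi; rewrite !mxE vi; apply/eqP.
have Qu : Q u = u + delta_mx 0 k.
  by rewrite tof_permE /ctrl big1 ?scale1r // => i _; rewrite mxE.
have Qfix i (v : 'rV['F_2]_n) : i != k -> i != l -> v 0 i = 1 -> Q (u + v) = u + v.
  move=> ik il vi; apply: (@tof_perm_fix _ _ i); last exact: uv.
  by rewrite controls_gate !inE negb_or ik il.
have Qj : Q (u + delta_mx 0 j) = u + delta_mx 0 j.
  by apply: (Qfix j) => //; rewrite 1?eq_sym // mxE !eqxx.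
have Qm : Q (u + delta_mx 0 m) = u + delta_mx 0 m.
  by apply: (Qfix m) => //; rewrite mxE !eqxx.
have Qmj : Q (u + delta_mx 0 m + delta_mx 0 j) = u + delta_mx 0 m + delta_mx 0 j.
  rewrite -addrA; apply: (Qfix m) => //.
  by rewrite !mxE !eqxx (negPf mj) addr0.
have := groupM PG (groupVr (groupJ PG QG)).
rewrite Pd conjMg !tpermJ Qu Qj Qm Qmj invMg.
by rewrite mulgA mulgK tpermV.
Qed.

(** * All transpositions lie in one coset, so the index is at most 2 *)

Local Open Scope group_scope.

Lemma rcoset_tpermE (T : finType) (G : {group {perm T}}) s (x y : T) :
  (G :* s == G :* tperm x y) = (s * tperm x y \in G).
Proof. by rewrite (sameP eqP rcoset_eqP) mem_rcoset tpermV. Qed.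

(** Conjugation gives (x z)(x y) = (x y)(y z), and the right side lies in [G] by hypothesis. *)
Lemma rcoset_tperm_trans (T : finType) (G : {group {perm T}}) (x y z : T) :
  x != z -> y != z -> G :* tperm x y = G :* tperm y z ->
  G :* tperm x z = G :* tperm x y.
Proof.
move=> xz yz /eqP; rewrite rcoset_tpermE => xyz; apply/eqP.
by rewrite rcoset_tpermE conjgC tpermJ_tperm.
Qed.

(** The transpositions (x y) with [x] fixed generate the symmetric group, and right multiplication
    by any of them exchanges [G] and [G :* t0]; so these two cosets cover everything. *)
Lemma card_perm_leq_double (T : finType) (G : {group {perm T}}) (x : T) t0 :
  (forall y, x != y -> G :* tperm x y = G :* t0) ->
  ((#|T|)`! <= 2 * #|G|)%N.
Proof.
move=> Gx.
have GU : setT \subset G :|: G :* t0.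
  rewrite -(gen_tperm x); apply/subsetP => s /gen_prodgP[k [c cT ->]] {s}.
  elim: k => [|k IHk] in c cT *; first by rewrite big_ord0 inE group1.
  rewrite big_ord_recr /=; set s := \prod_(i < k) _.
  have {IHk} sG : s \in G :|: G :* t0 by apply: IHk.
  have /imsetP[y _ ->] := cT ord_max.
  have [<-|xy] := eqVneq x y; first by rewrite tperm1 mulg1.
  move: sG; rewrite !in_setU => /orP[sG|st]; apply/orP; [right|left].
    by rewrite -(Gx y xy) mem_rcoset mulgK.
  by move: st; rewrite -(Gx y xy) mem_rcoset tpermV.
have := subset_leq_card GU; rewrite cardsT => leG.
have -> : ((#|T|)`! = #|{perm T}|)%N.
  rewrite -cardsT -card_perm; apply: eq_card => s; rewrite inE.
  by apply/subsetP => y _; rewrite inE.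
apply: leq_trans leG _; apply: leq_trans (leq_card_setU _ _) _.
by rewrite card_rcoset mul2n addnn.
Qed.

Lemma rcoset_edge n (x : 'rV['F_2]_n) (j k : 'I_n) : (3 < n)%N ->
  let u : 'rV['F_2]_n := const_mx 1%R in
  reversible n :* tperm x (x + delta_mx 0 j)%R =
  reversible n :* tperm u (u + delta_mx 0 k)%R.
Proof.
move=> n3 u; pose e i : 'rV['F_2]_n := delta_mx 0%R i.
have adj y i l :
    (* At a fixed vertex the coset does not depend on the direction: this is the result at [u],
       conjugated by the translation by y - u. *)
    reversible n :* tperm y (y + e i)%R = reversible n :* tperm y (y + e l)%R.
  have [->//|il] := eqVneq i l.
  have := tperm_adjacent_reversible n3 il.
  have sG := shift_reversible (y - u)%R.
  move/groupJr: sG => <-; rewrite conjMg !tpermJ !permE.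
  have E v : (u + v + (y - u) = y + v)%R by rewrite addrC addrA addrNK.
  rewrite !E addrC addrNK (tpermC (y + _)%R) -rcoset_tpermE => /eqP E1.
  apply/esym/(rcoset_tperm_trans _ _ E1).
    by rewrite -subr_eq0 opprD addrA subrr sub0r oppr_eq0 delta_neq0.
  rewrite (inj_eq (addrI y)); apply: contraNneq il => /rowP/(_ i).
  by rewrite !mxE !eqxx; case: eqP.
(* Walk from [u] to [x] one coordinate at a time: turn the edge into the direction of the move, read
   it from its other end, and turn it back. *)
rewrite (adj x j k) -[x](addrNK u) (addrC (x - u)%R) [(x - u)%R]row_sum_delta.
elim/big_rec: _ => [|i w _ <-]; first by rewrite addr0.
rewrite addrCA addrC.
have [->|] := eqVneq ((x - u)%R 0%R i) 0%R; first by rewrite scale0r addr0.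
rewrite F2_eq0 negbK => /eqP wi.
rewrite wi scale1r (adj _ k i) -(adj _ i k) /e -[(u + w + _ + _)%R]addrA addrr_F2 addr0.
by rewrite tpermC.
Qed.

(** Induction along a path from [x] to [y] that flips one coordinate at a time; each further edge is
    absorbed by [rcoset_tperm_trans]. *)
Lemma rcoset_tperm n (j : 'I_n) (x y : 'rV['F_2]_n) : (3 < n)%N -> x != y ->
  let u : 'rV['F_2]_n := const_mx 1%R in
  reversible n :* tperm x y = reversible n :* tperm u (u + delta_mx 0 j)%R.
Proof.
move=> n3 + u; rewrite -[y](addrNK x) (addrC (y - x)%R) [(y - x)%R]row_sum_delta.
elim/big_rec: _ => [|i w _ IHw]; first by rewrite addr0 eqxx.
rewrite addrCA addrC.
have [->|] := eqVneq ((y - x)%R 0%R i) 0%R; first by rewrite scale0r addr0.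
rewrite F2_eq0 negbK => /eqP ->; rewrite scale1r.
have [<- _|xw] := eqVneq x (x + w)%R; first exact: rcoset_edge.
move=> xwi; rewrite -(IHw xw); apply: rcoset_tperm_trans => //.
  by rewrite -subr_eq0 opprD addrA subrr sub0r oppr_eq0 delta_neq0.
by rewrite IHw //; apply/esym/rcoset_edge.
Qed.

Lemma card_reversible n : (3 < n)%N -> ((2 ^ n)`! <= 2 * #|reversible n|)%N.
Proof.
move=> n3; pose j := Ordinal (ltnW (ltnW (ltnW n3))).
pose u : 'rV['F_2]_n := const_mx 1%R.
have := @card_perm_leq_double _ [group of reversible n] u (tperm u (u + delta_mx 0 j)%R).
rewrite card_mx card_Fp // mul1n; apply.
by move=> y uy; apply: rcoset_tperm.
Qed.

Local Close Scope group_scope.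

(** * Additional inputs and the lower bound on the size of [F n q] *)

Definition lift_gate n q (g : tof n) : tof (n + q) :=
  gate [set lshift q i | i in controls g] (lshift q (target g)).

Lemma controls_lift_gate n q (g : tof n) :
  controls (lift_gate q g) = [set lshift q i | i in controls g].
Proof.
rewrite controls_gate; apply/setP => i; rewrite !inE; case: eqP => //= ->.
by rewrite (mem_imset _ _ (@lshift_inj _ _)) (negPf (valP g)).
Qed.

Lemma tof_fun_lift_gate n q (g : tof n) (x : 'rV['F_2]_n) :
  tof_fun (lift_gate q g) (row_mx x 0) = row_mx (tof_fun g x) 0.
Proof.
rewrite !tof_funE target_gate; set c := ctrl g x.
have -> : ctrl (lift_gate q g) (row_mx x 0) = c.
  rewrite /ctrl controls_lift_gate big_imset => [|i k _ _]; last exact: lshift_inj.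
  by apply: eq_bigr => i _; rewrite row_mxEl.
apply/rowP => i; rewrite -(splitK i); case: (split i) => k /=.
  by rewrite mxE !row_mxEl !mxE (inj_eq (@lshift_inj _ _)).
by rewrite mxE !row_mxEr !mxE eq_rlshift mulr0 addr0.
Qed.

Lemma reversible_F n q (p : {perm 'rV['F_2]_n}) :
  p \in reversible n -> finfun p \in F n q.
Proof.
move=> /reversibleP[s [sO sp]]; rewrite inE; apply/asboolP.
exists [seq lift_gate q g | g <- s]; split=> [h /mapP[g /sO gO ->]|].
  by move: gO; rewrite !inE controls_lift_gate card_imset //; apply: lshift_inj.
exists 1%g => x; rewrite ffunE -sp; apply/rowP => i; rewrite mxE perm1.
suff -> : circuit_fun [seq lift_gate q g | g <- s] (row_mx x 0) =
    row_mx (circuit_fun s x) 0.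
  by rewrite row_mxEl.
rewrite /circuit_fun; elim: s {sO sp} x => //= g s IHs x.
by rewrite tof_fun_lift_gate IHs.
Qed.

Lemma card_F_ge n q : (3 < n)%N -> ((2 ^ n)`! <= 2 * #|F n q|)%N.
Proof.
move=> n3; apply: leq_trans (card_reversible n3) _; rewrite leq_pmul2l //.
pose ff (p : {perm 'rV['F_2]_n}) := finfun p.
have ff_inj : injective ff.
  by move=> p r /ffunP E; apply/permP => x; have := E x; rewrite !ffunE.
rewrite -(card_imset _ ff_inj) subset_leq_card //.
apply/subsetP => _ /imsetP[p pG ->].
exact: reversible_F.
Qed.

(** * Coding of layers and the upper bound on the size of [F n q] *)

(* The code (a, b, c) at line k stands for the gate TOF({a, b} \ {k}; k) if c = k,
   and for no gate with target k otherwise. *)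
Definition layer_code N := {ffun 'I_N -> 'I_N * 'I_N * 'I_N}.

Definition layer_fun N (e : layer_code N) (x : 'rV['F_2]_N) : 'rV['F_2]_N :=
  \row_k (x 0 k + (if (e k).2 == k
                   then \prod_(i in [set (e k).1.1; (e k).1.2] :\ k) x 0 i
                   else 0)).

(** A repeated entry codes a singleton, and [x] taken twice codes the empty set. *)
Lemma set_leq2P (T : finType) (x : T) (A : {set T}) : (#|A| <= 2)%N -> x \notin A ->
  exists a b, A = [set a; b] :\ x.
Proof.
move=> A2 xA.
have Ax : A = A :\ x.
  by apply/setP => i; rewrite !inE; case: eqP => // ->; apply: negPf.
have [A0|An0] := eqVneq A set0; first by exists x, x; rewrite A0 setUid setDv.
suff [a [b Aab]] : exists a b, A = [set a; b] by exists a, b; rewrite -Aab.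
have [/eqP/cards2P[a [b [_ ->]]]|A1] := eqVneq #|A| 2%N; first by exists a, b.
have /cards1P[a ->] : #|A| == 1%N by rewrite eqn_leq card_gt0 An0 -ltnS ltn_neqAle A1 A2.
by exists a, a; rewrite setUid.
Qed.

(** Supports are disjoint, so no gate alters a line used by another, and all updates can be computed
    from the initial state. *)
Lemma layer_code_of_depth1 N (s : seq (tof N)) : (1 < N)%N ->
  {subset s <= Omega2 N} ->
  pairwise (fun g h => [disjoint Defs.support g & Defs.support h]) s ->
  exists e : layer_code N, circuit_fun s =1 layer_fun e.
Proof.
move=> N1 sO sP.
(* For the induction, [e] must also record that every coded gate occurs in [s], so that disjointness
   from a new gate applies to it. *)
suff [e [ee eE]] : exists e : layer_code N,
    (forall k, (e k).2 == k -> exists2 g, g \in s &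
      target g = k /\ controls g = [set (e k).1.1; (e k).1.2] :\ k) /\
    circuit_fun s =1 layer_fun e by exists e.
(* A line that is no target needs a third entry different from itself; this uses [1 < N]. *)
have neq (k : 'I_N) : exists c : 'I_N, c != k.
  apply/existsP; rewrite -negb_forall; apply/negP => /forallP Ek.
  have /subset_leq_card : [set: 'I_N] \subset [set k].
    by apply/subsetP => i _; rewrite inE Ek.
  by rewrite cardsT card_ord cards1 leqNgt N1.
elim: s sO sP => [|g s IHs] sO.
  move=> _; exists [ffun k => (k, k, xchoose (neq k))]; split=> [k|x].
    by rewrite ffunE /= (negPf (xchooseP (neq k))).
  by apply/rowP => k; rewrite mxE ffunE /= (negPf (xchooseP (neq k))) addr0.
rewrite pairwise_cons => /andP[/allP gs sP].
have [h hs|//|e [eA eE]] := IHs; first by apply: sO; rewrite inE hs orbT.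
have [a [b gab]] : exists a b, controls g = [set a; b] :\ target g.
  apply: set_leq2P; last exact: (valP g).
  by have := sO g (mem_head _ _); rewrite inE.
have disj h i : h \in s -> i \in Defs.support h -> i \notin Defs.support g.
  by move=> hs ih; rewrite (disjointFl (gs h hs) ih).
pose e' : layer_code N := [ffun k => if k == target g then (a, b, k) else e k].
exists e'; split=> [k|x].
  rewrite ffunE; case: (eqVneq k (target g)) => [-> _|kg /eA[h hs hk]].
    by exists g; rewrite ?mem_head.
  by exists h; rewrite // inE hs orbT.
rewrite [LHS]eE; apply/rowP => k; rewrite [LHS]mxE [RHS]mxE ffunE.
have tE i : i != target g -> tof_fun g x 0 i = x 0 i by move=> ig; rewrite mxE (negPf ig).
case: (eqVneq k (target g)) => [->|kg] /=.
  rewrite eqxx -gab mxE eqxx.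
  case: eqP => [/eqP/eA[h hs [ht _]]|_]; last by rewrite addr0.
  by have := disj h (target g) hs; rewrite !inE ht eqxx => /(_ isT).
rewrite tE //; congr (_ + _); case: ifP => // /eA[h hs [_ hc]].
rewrite -hc; apply: eq_bigr => i ih; apply: tE.
have := disj h i hs; rewrite !inE ih orbT => /(_ isT).
by rewrite negb_or => /andP[].
Qed.

Definition layers_fun N (t : seq (layer_code N)) (x : 'rV['F_2]_N) :=
  foldl (fun y e => layer_fun e y) x t.

Lemma layer_codes_of_circuit N (ss : seq (seq (tof N))) d : (1 < N)%N ->
  {subset flatten ss <= Omega2 N} -> all (@depth1 N) ss -> (size ss <= d)%N ->
  exists t : d.-tuple (layer_code N), circuit_fun (flatten ss) =1 layers_fun t.
Proof.
move=> N1; elim: d ss => [|d IHd] ss sO sD.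
  by rewrite leqn0 size_eq0 => /eqP->; exists [tuple].
(* When [ss] is exhausted, [head] returns the empty layer, which pads the code to length exactly
   [d]. *)
move=> sd; pose s := head [::] ss.
have defss : flatten ss = s ++ flatten (behead ss) by rewrite /s; case: (ss).
have [t tE] : exists t : d.-tuple (layer_code N),
    circuit_fun (flatten (behead ss)) =1 layers_fun t.
  apply: IHd; first by move=> g gs; apply: sO; rewrite defss mem_cat gs orbT.
    by case: (ss) sD => //= ? ? /andP[].
  by rewrite size_behead -subn1 leq_subLR.
have [||e eE] := @layer_code_of_depth1 N s N1.
- by move=> g gs; apply: sO; rewrite defss mem_cat gs.
- by rewrite /s; case: (ss) sD => //= ? ? /andP[/andP[]].
exists [tuple of e :: t] => x.
by rewrite defss /circuit_fun foldl_cat [foldl _ x s]eE [LHS]tE.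
Qed.

Lemma card_F_le n q : (1 < n + q)%N ->
  (#|F n q| <= (n + q) ^ (3 * (n + q) * D n q + n))%N.
Proof.
move=> N1; set d := D n q.
(* Only the values of the output permutation on the first [n] lines matter, so a function from
   ['I_n] replaces it and costs a factor N^n. *)
pose decode (c : d.-tuple (layer_code (n + q)) * {ffun 'I_n -> 'I_(n + q)}) :
    {ffun 'rV['F_2]_n -> 'rV['F_2]_n} :=
  [ffun x => \row_i layers_fun c.1 (row_mx x 0) 0 (c.2 i)].
have FD : F n q \subset decode @: [set: _].
  apply/subsetP => f fF; have [[s [sO [pi sf] sd]] _] := DfunP fF.
  have [[ss [sE sss ssD]] _] := depthP s.
  have le_d : (size ss <= d)%N.
    by rewrite sss sd; apply: leq_bigmax_cond.
  have [|t tE] := layer_codes_of_circuit N1 _ ssD le_d; first by rewrite sE.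
  apply/imsetP; exists (t, [ffun i => pi (lshift q i)]) => //.
  apply/ffunP => x; rewrite ffunE sf; apply/rowP => i.
  by rewrite !mxE ffunE -tE sE.
apply: leq_trans (subset_leq_card FD) _; apply: leq_trans (leq_imset_card _ _) _.
rewrite cardsT card_prod card_tuple !card_ffun !card_prod !card_ord.
set N := (n + q)%N; have -> : (N * N * N = N ^ 3)%N by rewrite !expnS muln1 mulnA.
by rewrite -!expnM -mulnA expnD.
Qed.

(** * Factorial estimate and passage to logarithms *)

Lemma fact_expn_le m k : ((m`!) * m ^ k <= (m + k)`!)%N.
Proof.
elim: k => [|k IHk]; first by rewrite muln1 addn0.
by rewrite addnS factS expnS mulnCA leq_mul // leqW // leq_addr.
Qed.

(** Induction by doubling, with m = 2^n: (2m)^(2m) = 4^m m^m m^m. The induction hypothesis bounds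
    one factor m^m, and m! m^m <= (2m)! absorbs the other. *)
Lemma expn_fact n : (0 < n)%N ->
  (2 * (2 ^ n) ^ (2 ^ n) <= 4 ^ (2 ^ n) * (2 ^ n)`!)%N.
Proof.
case: n => // n _; elim: n => // n IHn.
rewrite expnS; set m := (2 ^ n.+1)%N in IHn *.
have -> : ((2 * m) ^ (2 * m) = 4 ^ m * (m ^ m * m ^ m))%N.
  by rewrite expnMn expnM mul2n -addnn expnD.
have -> : (4 ^ (2 * m) = 4 ^ m * 4 ^ m)%N by rewrite mul2n -addnn expnD.
rewrite mulnCA -[leqRHS]mulnA leq_mul // mulnA.
apply: leq_trans (leq_mul IHn (leqnn _)) _.
by rewrite -mulnA leq_mul // mul2n -addnn fact_expn_le.
Qed.

(** The 2 in n - 2 is the cost of the factor 4^(2^n) in the factorial estimate. *)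
Lemma log2_bound (R : realType) (n N d : nat) : (1 < N)%N ->
  (2 ^ (n * 2 ^ n) <= 2 ^ (2 * 2 ^ n) * N ^ (3 * N * d + n))%N ->
  2 ^+ n * (n%:R - 2) / (3 * N%:R * log2 N%:R) - n%:R / (3 * N%:R) <= d%:R :> R.
Proof.
move=> N1 count.
have ln2_gt0 : 0 < ln 2 :> R by rewrite ln_gt0 // ltr1n.
have NR1 : 1 < N%:R :> R by rewrite ltr1n.
have NR0 : 0 < N%:R :> R := lt_trans ltr01 NR1.
have lnN_gt0 : 0 < ln N%:R :> R by rewrite ln_gt0.
have {}count : 2 ^+ n * (n%:R - 2) * ln 2 <= (3 * N%:R * d%:R + n%:R) * ln N%:R :> R.
  have : ln (2 ^+ (n * 2 ^ n)) <= ln (2 ^+ (2 * 2 ^ n) * N%:R ^+ (3 * N * d + n)) :> R.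
    rewrite ler_ln ?posrE ?mulr_gt0 ?exprn_gt0 //.
    by rewrite -!natrX -natrM ler_nat.
  rewrite lnM ?posrE ?exprn_gt0 // !lnXn // -!(mulr_natl (ln _)) natrD !natrM natrX.
  lra.
rewrite lerBlDr /log2 ler_pdivrMr; last by rewrite !mulr_gt0 ?invr_gt0.
rewrite -(ler_pM2r ln2_gt0); apply: le_trans count _.
rewrite le_eqVlt; apply/orP; left; apply/eqP; field.
by rewrite !gt_eqF.
Qed.

Theorem theorem2 (R : realType) :
  exists n0 : nat, forall n q : nat, (n0 < n)%N ->
    2 ^+ n * (n%:R - 2) / (3 * (n + q)%:R * log2 (n + q)%:R)
      - n%:R / (3 * (n + q)%:R)
    <= (D n q)%:R :> R.
Proof.
(* The value 3 guarantees the four distinct lines used to build a 3-cycle. *)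
exists 3 => n q n3.
have N1 : (1 < n + q)%N by rewrite (leq_trans _ (leq_addr q n)) // ltnW // ltnW.
apply: log2_bound => //.
(* Doubling both sides lets the 2 in [expn_fact] cancel the index 2 in [card_F_ge]. *)
rewrite -(leq_pmul2l (ltn0Sn 1)) (expnM _ n).
apply: leq_trans (expn_fact (ltnW (ltnW (ltnW n3)))) _.
rewrite mulnCA (expnM 2 2) leq_mul //.
by apply: leq_trans (card_F_ge q n3) _; rewrite leq_mul // card_F_le.
Qed.
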